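(* Let $X_n$ be the number of correct guesses in the card guessing game with complete feedback after a single shelf shuffle of $n$ cards. The bivariate generating function $S(z,v)=\sum_{n\ge 1}\mathbb E(v^{X_n})z^n$ is given by $$S(z,v)=\frac{zv+\dfrac{\frac{z^2v}{2}}{1-\frac{zv}{2}}}{1-\frac{zv}{2}-\dfrac{\frac z2}{1-\frac{zv}{2}}+\frac z2}=\frac{2zv\,\bigl(2+(1-v)z\bigr)}{4-4vz+(v^2-v)z^2}.$$
   Context: Single shelf shuffle: an ordered deck of $n$ cards labelled $1,\dots,n$ (card $1$ on top, card $n$ at the bottom) is given. Cards are drawn one by one from the bottom of the deck (so in the order $n,n-1,\dots,1$) and put on an initially empty pile; each drawn card is placed, independently, at the top or at the bottom of the pile with probability $1/2$ each. The final pile is the shuffled deck. Game: cards are drawn one after the other from the top of the shuffled deck. Before each draw the player guesses the label of the card; afterwards the card is shown (complete feedback). The player uses the following optimal strategy: the first guess is card $1$; as long as neither card $n-1$ nor card $n$ has been shown, the next guess is the label immediately following that of the most recently shown card; once one of the cards $n-1$ or $n$ has been shown, the player guesses the remaining (not yet shown) cards in descending order. $X_n$ denotes the total number of correct guesses. The identity is understood as an identity of formal power series in $z$ with coefficients polynomials in $v$. *)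

(* Defs.v *)
(* Power series get their choice structure from classical choice, and their
   equality is extensional by functional extensionality (both from boolp). *)
From HB Require Import structures.
From mathcomp Require Import all_boot all_order all_algebra.
From mathcomp Require Import boolp.

Set Implicit Arguments.
Unset Strict Implicit.
Unset Printing Implicit Defensive.

Import Order.TTheory GRing.Theory Num.Theory.

Local Open Scope ring_scope.

(* A wrapper is needed: on bare functions nat -> A the library's ring product
   is pointwise. *)
Record fps (A : Type) := FPS { fcoef : nat -> A }.

Notation "{ 'fps' A }" := (fps A) (at level 0, format "{ 'fps'  A }").

HB.instance Definition _ (A : Type) := gen_eqMixin {fps A}.
HB.instance Definition _ (A : Type) := gen_choiceMixin {fps A}.

Lemma fpsP (A : Type) (f g : {fps A}) : fcoef f =1 fcoef g <-> f = g.
Proof.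
split=> [|-> //]; case: f g => [f] [g] /= fg.
by congr FPS; apply: functional_extensionality_dep.
Qed.

Section FpsRing.
Variable A : comNzRingType.
Implicit Types f g h : {fps A}.

Definition fps_zero : {fps A} := FPS (fun=> 0).
Definition fps_opp f : {fps A} := FPS (fun n => - fcoef f n).
Definition fps_add f g : {fps A} := FPS (fun n => fcoef f n + fcoef g n).
Definition fpsC (a : A) : {fps A} := FPS (fun n => if n == 0%N then a else 0).
Definition fpsX : {fps A} := FPS (fun n => (n == 1%N)%:R).
Definition fps_mul f g : {fps A} :=
  FPS (fun n => \sum_(i < n.+1) fcoef f i * fcoef g (n - i)%N).

Fact fps_addA : associative fps_add.
Proof. by move=> f g h; apply/fpsP => n /=; rewrite addrA. Qed.
Fact fps_addC : commutative fps_add.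
Proof. by move=> f g; apply/fpsP => n /=; rewrite addrC. Qed.
Fact fps_add0 : left_id fps_zero fps_add.
Proof. by move=> f; apply/fpsP => n /=; rewrite add0r. Qed.
Fact fps_addN : left_inverse fps_zero fps_opp fps_add.
Proof. by move=> f; apply/fpsP => n /=; rewrite addNr. Qed.

HB.instance Definition _ :=
  GRing.isZmodule.Build {fps A} fps_addA fps_addC fps_add0 fps_addN.

Definition fps_trunc (m : nat) f : {poly A} := \poly_(i < m) fcoef f i.

Lemma coef_mul_trunc m f g n : (n < m)%N ->
  fcoef (fps_mul f g) n = (fps_trunc m f * fps_trunc m g)`_n.
Proof.
move=> nm; rewrite coefM; apply: eq_bigr => i _; rewrite !coef_poly.
by rewrite (leq_ltn_trans _ nm) ?(leq_ltn_trans (leq_subr _ _) nm) // -ltnS.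
Qed.

Lemma coefM_eq_low (p p' q : {poly A}) n :
  (forall i, (i <= n)%N -> p`_i = p'`_i) -> (p * q)`_n = (p' * q)`_n.
Proof.
by move=> pp'; rewrite !coefM; apply: eq_bigr => i _; rewrite pp' // -ltnS.
Qed.

Lemma coef_trunc_mul m f g n : (n < m)%N ->
  (fps_trunc m (fps_mul f g))`_n = (fps_trunc m f * fps_trunc m g)`_n.
Proof. by move=> nm; rewrite coef_poly nm (coef_mul_trunc _ _ nm). Qed.

Fact fps_mulC : commutative fps_mul.
Proof.
by move=> f g; apply/fpsP => n; rewrite !(@coef_mul_trunc n.+1) // mulrC.
Qed.

Fact fps_mulA : associative fps_mul.
Proof.
move=> f g h; apply/fpsP => n; rewrite !(@coef_mul_trunc n.+1) //.
have low u v i : (i <= n)%N -> (fps_trunc n.+1 (fps_mul u v))`_i =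
  (fps_trunc n.+1 u * fps_trunc n.+1 v)`_i by move=> ?; apply: coef_trunc_mul.
rewrite [RHS](coefM_eq_low _ (low f g)) mulrC.
by rewrite [LHS](coefM_eq_low _ (low g h)) mulrC mulrA.
Qed.

Fact fps_mul1 : left_id (fpsC 1) fps_mul.
Proof.
move=> f; apply/fpsP => n /=; rewrite big_ord_recl /= mul1r subn0.
by rewrite big1 ?addr0 // => i _; rewrite mul0r.
Qed.

Fact fps_mulDl : left_distributive fps_mul fps_add.
Proof.
move=> f g h; apply/fpsP => n /=; rewrite -big_split /=.
by apply: eq_bigr => i _; rewrite mulrDl.
Qed.

Fact fps_one_neq0 : fpsC 1 != fps_zero.
Proof. by apply/eqP => /fpsP/(_ 0%N)/= /eqP; rewrite oner_eq0. Qed.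

HB.instance Definition _ := GRing.Zmodule_isComNzRing.Build {fps A}
  fps_mulA fps_mulC fps_mul1 fps_mulDl fps_one_neq0.

Lemma fcoefD f g n : fcoef (f + g) n = fcoef f n + fcoef g n.
Proof. by []. Qed.
Lemma fcoefN f n : fcoef (- f) n = - fcoef f n.
Proof. by []. Qed.
Lemma fcoefM f g n :
  fcoef (f * g) n = \sum_(i < n.+1) fcoef f i * fcoef g (n - i)%N.
Proof. by []. Qed.
Lemma fcoef1 n : fcoef (1 : {fps A}) n = (n == 0%N)%:R.
Proof. by case: n. Qed.

End FpsRing.

Section FpsUnit.
Variable A : comUnitRingType.
Implicit Types f g : {fps A}.

(* First n coefficients of f^-1, by
   g_k = f_0^-1 ([k = 0] - \sum_(i < k) f_(k - i) g_i). *)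
Fixpoint fps_inv_seq f (n : nat) : seq A :=
  if n is k.+1 then
    let s := fps_inv_seq f k in
    rcons s ((fcoef f 0)^-1 *
      ((k == 0%N)%:R - \sum_(i < k) fcoef f (k - i)%N * s`_i))
  else [::].

Definition fps_unit : {pred {fps A}} := fun f => fcoef f 0 \is a GRing.unit.

Definition fps_inv f : {fps A} :=
  if f \in fps_unit then FPS (fun n => (fps_inv_seq f n.+1)`_n) else f.

Lemma size_fps_inv_seq f n : size (fps_inv_seq f n) = n.
Proof. by elim: n => //= n IHn; rewrite size_rcons IHn. Qed.

Lemma nth_fps_inv_seq f n k : (k < n)%N ->
  (fps_inv_seq f n)`_k = (fps_inv_seq f k.+1)`_k.
Proof.
elim: n => // n IHn; rewrite ltnS leq_eqVlt => /predU1P[-> // | kn].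
by rewrite [LHS]/= nth_rcons size_fps_inv_seq kn IHn.
Qed.

Fact fps_mulV : {in fps_unit, left_inverse 1 fps_inv *%R}.
Proof.
move=> f Uf; apply/fpsP => n; rewrite /fps_inv Uf fcoefM fcoef1.
rewrite big_ord_recr /= subnn nth_rcons size_fps_inv_seq ltnn eqxx.
rewrite (mulrC (_ * _)) mulrA mulrV // mul1r addrC.
set s1 := (X in _ - X + _); set s2 := (X in _ + X = _).
suff -> : s2 = s1 by rewrite subrK.
apply: eq_bigr => i _; rewrite mulrC.
by rewrite (nth_fps_inv_seq f (ltn_ord i)).
Qed.

Fact fps_unitP f g : g * f = 1 -> fps_unit f.
Proof.
move/fpsP/(_ 0%N); rewrite fcoefM fcoef1 big_ord1 /= => gf1.
by apply/unitrPr; exists (fcoef g 0); rewrite mulrC.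
Qed.

Fact fps_inv_out : {in [predC fps_unit], fps_inv =1 id}.
Proof. by move=> f; rewrite /fps_inv inE => /negPf->. Qed.

HB.instance Definition _ :=
  GRing.ComNzRing_hasMulInverse.Build {fps A} fps_mulV fps_unitP fps_inv_out.

End FpsUnit.

Section Shuffle.
Variable n : nat.

(* The j-th coin governs the j-th drawn card, i.e. card n - j for j = 0, 1, ...;
   true means top of the pile.  Decks are listed from top to bottom. *)
Definition shelf_shuffle (coins : n.-tuple bool) : seq nat :=
  foldl (fun pile d => if d.2 then d.1 :: pile else rcons pile d.1)
        [::] (zip (rev (iota 1 n)) coins).

(* [shown] lists the cards seen so far, the most recent one last. *)
Definition next_guess (shown : seq nat) : nat :=
  if (n.-1 \in shown) || (n \in shown)
  then \max_(1 <= c < n.+1 | c \notin shown) c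
  else if shown is c :: s then (last c s).+1 else 1%N.

Definition correct_guesses (deck : seq nat) : nat :=
  \sum_(0 <= i < size deck) (next_guess (take i deck) == nth 0%N deck i).

(* Each outcome of n independent fair coins has probability (1/2)^n. *)
Definition shelf_pgf (R : numFieldType) : {poly R} :=
  \sum_(coins : n.-tuple bool)
    (2^-1 ^+ n) *: 'X^(correct_guesses (shelf_shuffle coins)).

End Shuffle.

(* The indeterminate of the coefficient ring {poly R} is v. *)
Definition shelf_gf (R : numFieldType) : {fps {poly R}} :=
  FPS (fun n => if n == 0%N then 0 else shelf_pgf n R).

(* Main.v *)
(* Read from top to bottom, the shuffled deck is an increasing sequence (the
   cards put on top), then card n, then the remaining cards in decreasing order.
   Only the increasing part and card n are at risk: from card n - 1 or n on,
   every guess is right.  Encode the coins of cards 1, ..., n - 1 as a word w of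
   "top" and "bottom" letters.  A bottom card is always guessed, and a top card
   (including n, which counts as top) exactly when its predecessor is a top card
   (card 1 counting as preceded by one).  So the number of correct guesses is an
   additive functional of the two-state chain w, and the two generating functions,
   by state, solve a 2x2 linear system. *)
Require Import Defs.
From HB Require Import structures.
From mathcomp Require Import all_boot all_order all_algebra.
From mathcomp Require Import ring.

Import Order.TTheory GRing.Theory Num.Theory.
Local Open Scope ring_scope.

(** * From coin words to shuffled decks and correct guesses *)

Section Deck.
Local Open Scope nat_scope.

(** The pile is kept general for the induction: each top card lands above the earlier ones, hence
    the [rev], and each bottom card below them. *)
Lemma foldl_shelf (pile cards : seq nat) (coins : seq bool) :
  size coins = size cards ->
  foldl (fun pile d => if d.2 then d.1 :: pile else rcons pile d.1)
      pile (zip cards coins)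
    = rev (mask coins cards) ++ pile ++ mask (map negb coins) cards.
Proof.
elim: coins cards pile => [|b coins IH] [|c cards] pile //=; first by rewrite cats0.
case=> sz; rewrite IH //; case: b => /=; first by rewrite rev_cons cat_rcons.
by rewrite cat_rcons.
Qed.

(* The head coin [b] belongs to card m + 1, which is drawn first and so is
   unaffected by it; the list of coins is reversed because card 1 is drawn last. *)
Lemma shelf_shuffle_cons m (b : bool) (w : m.-tuple bool) :
  shelf_shuffle [tuple of b :: [tuple of rev w]]
    = mask w (iota 1 m) ++ m.+1 :: rev (mask (map negb w) (iota 1 m)).
Proof.
rewrite /shelf_shuffle foldl_shelf; last by rewrite size_rev size_iota size_tuple.
have -> : iota 1 m.+1 = rcons (iota 1 m) m.+1.
  by rewrite -[in LHS](addn1 m) iotaD cats1 add1n.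
rewrite rev_rcons /= map_rev.
have sz : size w = size (iota 1 m) by rewrite size_iota size_tuple.
rewrite -!rev_mask ?size_map //.
by case: b; rewrite /= ?rev_cons revK ?cat_rcons.
Qed.

(** Hits of the successor rule; starting at a fictitious card [x = 0] makes card 1 the first
    guess. *)
Fixpoint succ_count (x : nat) (s : seq nat) : nat :=
  if s is y :: s' then (x.+1 == y) + succ_count y s' else 0.

Lemma succ_countE x s :
  succ_count x s
    = \sum_(0 <= i < size s) ((last x (take i s)).+1 == nth 0 s i).
Proof.
elim: s x => [|y s IH] x /=; first by rewrite big_geq.
by rewrite big_nat_recl //= IH.
Qed.

(* The correct guesses as a function of the word [w] (true = top); [p] tells
   whether the card preceding the first letter of [w] is a top card. *)
Fixpoint score (p : bool) (w : seq bool) : nat :=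
  if w is t :: w' then
    if t then p + score true w' else (score false w').+1
  else p.

(** Read [x] as the last top card among cards 1 to [k] (0 if there is none): [x == k] then says that
    card [k] is on top. A bottom letter advances [k] past [x], which turns the flag off. *)
Lemma score_succ_count x k w : x <= k ->
  succ_count x (rcons (mask w (iota k.+1 (size w))) (k + size w).+1)
    + count negb w = score (x == k) w.
Proof.
elim: w x k => [|t w IH] x k xk /=.
  by rewrite addn0 eqSS !addn0.
case: t => /=; rewrite addnS -addSn.
  by rewrite eqSS add0n -addnA IH // eqxx.
rewrite add1n addnS IH; last exact: leqW.
by rewrite (ltn_eqF (n := k.+1)) // ltnS.
Qed.

Lemma max_unshown n (shown : seq nat) c :
  0 < c <= n -> c \notin shown ->
  (forall d, c < d <= n -> d \in shown) ->
  \max_(1 <= d < n.+1 | d \notin shown) d = c.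
Proof.
move=> /andP[c0 cn] cNs gtc; apply/eqP; rewrite eqn_leq; apply/andP; split.
  apply/bigmax_leqP_seq => d; rewrite mem_index_iota ltnS => /andP[_ dn] dNs.
  by rewrite leqNgt; apply/negP => cd; rewrite gtc ?cd in dNs.
by apply: (@leq_bigmax_seq _ _ _ id); rewrite // mem_index_iota c0 ltnS.
Qed.

(** A later entry would exceed the maximum. Applied to card [m] of a deck of [m.+1] cards, this
    shows that the descending guesses cannot start inside the increasing part. *)
Lemma index_max (s : seq nat) m :
  sorted ltn s -> (forall d, d \in s -> d <= m) -> m \in s ->
  (index m s).+1 = size s.
Proof.
move=> s_lt s_le ms; apply/eqP; rewrite eqn_leq index_mem ms leqNgt /=.
apply/negP => lt_s.
have := sorted_ltn_nth ltn_trans 0 s_lt (index m s) (index m s).+1.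
rewrite !inE index_mem ms lt_s nth_index // => /(_ isT isT (ltnSn _)).
by rewrite ltnNge s_le // mem_nth.
Qed.

(** The sum is split just after card [m.+1]: up to there a guess hits exactly when the successor
    rule does, and afterwards every guess hits. *)
Lemma correct_guessesE m (s1 s2 : seq nat) :
  sorted ltn s1 -> sorted gtn s2 ->
  perm_eq (s1 ++ s2) (iota 1 m) ->
  correct_guesses m.+1 (s1 ++ m.+1 :: s2)
    = succ_count 0 (rcons s1 m.+1) + size s2.
Proof.
move=> s1_lt s2_gt s12.
have mem12 d : (d \in s1) || (d \in s2) = (0 < d <= m).
  by rewrite -mem_cat (perm_mem s12) mem_iota add1n ltnS.
have s1_le d : d \in s1 -> d <= m.
  by move=> ds; have := mem12 d; rewrite ds /= => /esym/andP[].
have s2_le d : d \in s2 -> 0 < d <= m by rewrite -mem12 orbC => ->.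
have u12 : uniq (s1 ++ s2) by rewrite (perm_uniq s12) iota_uniq.
have mS1 : m.+1 \notin s1 by apply/negP => /s1_le; rewrite ltnn.
rewrite /correct_guesses size_cat /= addnS -addSn.
rewrite (@big_cat_nat _ _ _ (size s1).+1) //=; last by rewrite leq_addr.
rewrite succ_countE size_rcons; congr (_ + _).
  apply: eq_big_nat => i; rewrite ltnS => /andP[_ i_le].
  rewrite -cat_rcons nth_cat size_rcons ltnS i_le.
  rewrite takel_cat ?size_rcons; last exact: leqW.
  rewrite nth_rcons -cats1 takel_cat // /next_guess.
  have -> : m.+1 \in take i s1 = false.
    by apply: contraNF mS1 => /mem_take.
  rewrite orbF /=.
  move: i_le; rewrite leq_eqVlt => /predU1P[-> | i_lt].
    rewrite ltnn eqxx take_size.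
    (* If [m] has been shown, the guess is [m.+1], the largest unshown card; since [m] ends [s1],
       the successor rule gives the same guess. *)
    case: ifP => [ms|_]; last by case: (s1).
    rewrite (max_unshown _ _ m.+1) ?leqnn //; last first.
      by move=> d /andP[d1 d2]; rewrite ltnNge d2 in d1.
    by rewrite eqxx -nth_last -(index_max _ m) //= nth_index // eqxx.
  have -> : m \in take i s1 = false.
    apply/negP => mi; have ms := mem_take mi.
    by rewrite in_take // ltnNge -ltnS (index_max _ m) // i_lt in mi.
  by rewrite i_lt; case: take.
rewrite -{1}[(size s1).+1]add0n big_addn addKn.
rewrite -[RHS]muln1 -[X in X * 1]subn0 -sum_nat_const_nat.
apply: eq_big_nat => i /andP[_ i_lt].
rewrite -cat_rcons take_cat nth_cat size_rcons ltnNge leq_addl /= addnK.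
(* [c] is the largest unshown card: a larger one is [m.+1], lies in [s1], or precedes [c] in the
   decreasing [s2]. *)
set c := nth 0 s2 i; have cs2 : c \in s2 by rewrite mem_nth.
have /andP[c0 cm] := s2_le c cs2.
rewrite /next_guess [m.+1 \in _]mem_cat mem_rcons inE eqxx /= orbT.
rewrite (max_unshown _ _ c) ?eqxx ?c0 //=; first exact: leqW.
  rewrite mem_cat mem_rcons inE !negb_or ltn_eqF //=.
  move: u12; rewrite cat_uniq => /and3P[_ /hasPn/(_ c cs2)/= -> us2] /=.
  by rewrite in_take // index_uniq // ltnn.
move=> d /andP[cd]; rewrite leq_eqVlt ltnS mem_cat mem_rcons inE => /predU1P[-> | dm].
  by rewrite eqxx.
have : (d \in s1) || (d \in s2) by rewrite mem12 dm (leq_trans _ cd).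
case/orP => ds; first by rewrite ds orbT.
rewrite in_take // ltnNge; apply/orP; right; apply/negP => ij.
have gt_trans : transitive gtn by move=> x y z /= yx xz; apply: ltn_trans yx.
move: ij; rewrite leq_eqVlt => /predU1P[ij|ij].
  by move: cd; rewrite /c ij nth_index // ltnn.
have := sorted_ltn_nth gt_trans 0 s2_gt i (index d s2).
rewrite !inE index_mem ds i_lt => /(_ isT isT ij).
by rewrite nth_index //= ltnNge ltnW.
Qed.

Lemma perm_mask_negb (T : eqType) (w : seq bool) (s : seq T) :
  size w = size s -> perm_eq (mask w s ++ mask (map negb w) s) s.
Proof.
elim: w s => [|[] w IH] [|x s] //= [/IH ws]; first by rewrite perm_cons.
by rewrite -cat1s perm_catCA perm_cons.
Qed.

Lemma correct_guesses_shelf m (b : bool) (w : m.-tuple bool) :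
  correct_guesses m.+1 (shelf_shuffle [tuple of b :: [tuple of rev w]])
    = score true w.
Proof.
have sz : size w = size (iota 1 m) by rewrite size_iota size_tuple.
rewrite shelf_shuffle_cons correct_guessesE.
- rewrite size_rev size_mask ?size_map // count_map.
  by rewrite -(@score_succ_count 0 0 w) // size_tuple.
- exact: sorted_mask ltn_trans _ _ (iota_ltn_sorted 1 m).
- rewrite rev_sorted; apply: (sorted_mask ltn_trans).
  exact: iota_ltn_sorted.
- apply: perm_trans (perm_mask_negb _ _ _ sz).
  by rewrite perm_cat2l perm_rev.
Qed.

End Deck.

(** * Coefficients and units of power series *)

Section Fps.
Variable A : comNzRingType.
Implicit Types f g : {fps A}.

Lemma fcoefXM f n :
  fcoef (fpsX A * f) n = if n is m.+1 then fcoef f m else 0.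
Proof.
case: n => [|m]; rewrite fcoefM; first by rewrite big_ord1 mul0r.
rewrite 2!big_ord_recl mul0r add0r mul1r subn1 big1 ?addr0 // => i _.
by rewrite mul0r.
Qed.

Lemma fcoefCM (a : A) f n : fcoef (fpsC a * f) n = a * fcoef f n.
Proof.
by rewrite fcoefM big_ord_recl subn0 big1 ?addr0 // => i _; rewrite mul0r.
Qed.

End Fps.

Section FpsUnit.
Variable A : comUnitRingType.
Implicit Types f g : {fps A}.

Lemma fps_unitE f : (f \is a GRing.unit) = (fcoef f 0 \is a GRing.unit).
Proof. by []. Qed.

(** The constant term alone decides invertibility, and a multiple of [fpsX] does not change it. *)
Lemma unitr_fpsDXM f g : (f + fpsX A * g \is a GRing.unit) = (f \is a GRing.unit).
Proof. by rewrite !fps_unitE fcoefD fcoefXM addr0. Qed.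

Lemma fcoef0_nat n : fcoef (n%:R : {fps A}) 0 = n%:R.
Proof. by elim: n => // n IH; rewrite !mulrS fcoefD IH. Qed.

End FpsUnit.

Lemma big_tuple_cons (V : nmodType) m (F : m.+1.-tuple bool -> V) :
  \sum_w F w = \sum_(b : bool) \sum_(w : m.-tuple bool) F [tuple of b :: w].
Proof.
rewrite pair_big (reindex (fun bw : bool * m.-tuple bool =>
  [tuple of bw.1 :: bw.2])) /=; first by [].
exists (fun w : m.+1.-tuple bool => (thead w, [tuple of behead w])).
  by move=> [b w] _; congr pair; apply: val_inj.
by move=> w _; rewrite -tuple_eta.
Qed.

(** * Generating functions of the two-state chain *)

Section ScoreGf.
Variable R : numFieldType.

Definition score_pgf (p : bool) (m : nat) : {poly R} :=
  \sum_(w : m.-tuple bool) (2^-1 ^+ m) *: 'X^(score p w).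

Definition score_gf (p : bool) : {fps {poly R}} := FPS (score_pgf p).

Lemma score_pgf0 p : score_pgf p 0 = 'X^p.
Proof.
rewrite /score_pgf (big_pred1 [tuple]) ?expr0 ?scale1r //.
by move=> w; rewrite [RHS]eq_sym; apply/esym/eqP; rewrite [RHS]tuple0.
Qed.

(** Condition on the first letter; the factor 2 clears its probability. *)
Lemma score_pgfS p m :
  2 * score_pgf p m.+1 = 'X^p * score_pgf true m + 'X * score_pgf false m.
Proof.
rewrite {1}/score_pgf big_tuple_cons big_bool mulrDr !mulr_sumr.
have half : 2 * (2^-1 : R)%:P = 1.
  by rewrite -polyC_natr -polyCM divff // pnatr_eq0.
congr (_ + _); apply: eq_bigr => w _; rewrite /= -!mul_polyC exprS polyCM.
  rewrite exprD -[RHS]mul1r -[in RHS]half.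
  by move: (2^-1)%:P (_ ^+ m)%:P => h c; ring.
rewrite exprS -[RHS]mul1r -[in RHS]half.
by move: (2^-1)%:P (_ ^+ m)%:P => h c; ring.
Qed.

(** The coin of the first drawn card averages out, and reversing the other coins permutes the
    outcomes. *)
Lemma shelf_pgfS m : shelf_pgf m.+1 R = score_pgf true m.
Proof.
rewrite /shelf_pgf big_tuple_cons big_bool.
suff E b : \sum_(w : m.-tuple bool) (2^-1 ^+ m.+1) *: 'X^(correct_guesses m.+1
    (shelf_shuffle [tuple of b :: w])) = 2^-1 *: score_pgf true m.
  by rewrite !E /= -scalerDl -[2^-1]mul1r -splitr scale1r.
rewrite /score_pgf scaler_sumr.
rewrite (reindex_inj (h := fun w : m.-tuple bool => [tuple of rev w])) /=.
  apply: eq_bigr => w _; rewrite scalerA exprS.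
  by congr (_ *: 'X^_); apply: correct_guesses_shelf.
by apply: inv_inj => w; apply: val_inj; rewrite /= revK.
Qed.

Local Notation z := (fpsX {poly R}).
Local Notation v := (fpsC ('X : {poly R})).

(** The term [2 * v ^+ p] comes from the empty word, whose score is [p]. *)
Lemma score_gfE p :
  2 * score_gf p
    = 2 * v ^+ p + z * (v ^+ p * score_gf true + v * score_gf false).
Proof.
apply/fpsP => n; rewrite !mulr_natl !mulr2n !fcoefD fcoefXM.
case: n => [|n].
  rewrite addr0 /= score_pgf0.
  by case: p.
rewrite -mulr2n -mulr_natl [LHS]score_pgfS fcoefD fcoefCM.
by case: p; rewrite !(expr0, expr1) ?mul1r ?fcoefCM /= !add0r.
Qed.

Lemma shelf_gfE : shelf_gf R = z * score_gf true.
Proof.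
by apply/fpsP => -[|m]; rewrite fcoefXM //= shelf_pgfS.
Qed.

(** The second factor is the determinant [(2 - z * v) ^+ 2 - z ^+ 2 * v] of the linear system
    [score_gfE]. *)
Lemma shelf_gf_denominator :
  shelf_gf R * (4 - 4 * v * z + (v ^+ 2 - v) * z ^+ 2)
    = 2 * z * v * (2 + (1 - v) * z).
Proof.
rewrite shelf_gfE; have := score_gfE true; have := score_gfE false.
move: (score_gf true) (score_gf false) => a b.
rewrite expr0 expr1 => /eqP; rewrite -subr_eq0 => /eqP eb.
move=> /eqP; rewrite -subr_eq0 => /eqP ea.
apply/eqP; rewrite -subr_eq0; apply/eqP.
(* Cramer's rule for the 2x2 linear system [ea], [eb] in the unknowns [a], [b] *)
transitivity (z * ((2 - z * v) * 0 + z * v * 0)); last by ring.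
by rewrite -{1}ea -eb; ring.
Qed.

End ScoreGf.

Theorem lemma3 (R : numFieldType) :
  let z : {fps {poly R}} := fpsX {poly R} in
  let v : {fps {poly R}} := fpsC 'X in
  shelf_gf R
    = (z * v + (z ^+ 2 * v / 2) / (1 - z * v / 2))
      / (1 - z * v / 2 - (z / 2) / (1 - z * v / 2) + z / 2)
  /\
  (z * v + (z ^+ 2 * v / 2) / (1 - z * v / 2))
      / (1 - z * v / 2 - (z / 2) / (1 - z * v / 2) + z / 2)
    = (2 * z * v * (2 + (1 - v) * z))
      / (4 - 4 * v * z + (v ^+ 2 - v) * z ^+ 2).
Proof.
move=> z v.
have unit_nat n : (n.+1%:R : {fps {poly R}}) \is a GRing.unit.
  by rewrite fps_unitE fcoef0_nat -polyC_natr rmorph_unit // unitfE pnatr_eq0.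
have U2 : (2 : {fps {poly R}}) \is a GRing.unit by exact: unit_nat.
set w := 1 - z * v / 2.
have Uw : w \is a GRing.unit.
  have -> : w = 1 + z * - (v / 2) by rewrite mulrN mulrA.
  by rewrite unitr_fpsDXM unitr1.
set N := z * v + _; set D := w - _ + _.
set D' := 4 - _ + _.
have UD' : D' \is a GRing.unit.
  have -> : D' = 4 + z * ((v ^+ 2 - v) * z - 4 * v) by rewrite /D'; ring.
  by rewrite unitr_fpsDXM unit_nat.
have ww : w^-1 * w = 1 by rewrite mulVr.
have wE : 2 * w = 2 - z * v by rewrite mulrBr mulr1 mulrCA mulrV ?mulr1.
have hE : 2^-1 * 2 = 1 :> {fps {poly R}} by rewrite mulVr.
(* Scaling [N] and [D] by [4 * w] clears their inner fractions. *)
have ED : 4 * w * D = D'.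
  (* [2^-1 * 2] and [w^-1 * w] are first left uncancelled, so that [ring] can treat both inverses as
     variables. *)
  rewrite /D /D'.
  transitivity ((2 * w) ^+ 2 - (2^-1 * 2) * (w^-1 * w) * (2 * z)
                 + (2^-1 * 2) * z * (2 * w)).
    by move: (w^-1) (2^-1) => i h; ring.
  by rewrite hE ww wE; ring.
have EN : 4 * w * N = 2 * z * v * (2 + (1 - v) * z).
  rewrite /N.
  transitivity (2 * z * v * (2 * w) + (2^-1 * 2) * (w^-1 * w) * (2 * z ^+ 2 * v)).
    by move: (w^-1) (2^-1) => i h; ring.
  by rewrite hE ww wE; ring.
have UD : D \is a GRing.unit by move: UD'; rewrite -ED unitrM => /andP[].
have second : N / D = 2 * z * v * (2 + (1 - v) * z) / D'.
  apply: (canRL (mulrK UD')).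
  by rewrite -ED -EN [_ * w * D]mulrC mulrA divrK // mulrC.
split=> //; rewrite second; apply: (canRL (mulrK UD')).
exact: shelf_gf_denominator.
Qed.
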